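(* Let $\Gamma=(I,r)$ be a quitting game with $r^i(Q^i,C^{-i})=0$ for each $i\in I$, and let $R(\Gamma)=(r^i(Q^j,C^{-j}))_{i,j\in I}$. If $R(\Gamma)$ and all its principal minors (i.e. all principal submatrices $(r^i(Q^j,C^{-j}))_{i,j\in J}$, $\emptyset\neq J\subseteq I$) are $Q$-matrices, then $\Gamma$ has a continuous equilibrium.
   Context: A quitting game is a pair $\Gamma=(I,r)$ with $I$ a finite set of players and $r:A\to\mathbb{R}^I$ a payoff function, where $A=\prod_{i\in I}A^i$, $A^i=\{C^i,Q^i\}$ (continue, quit). Set $\vec C=(C^i)_{i\in I}$, $A^*=A\setminus\{\vec C\}$, $C^{-i}=(C^j)_{j\neq i}$, $A^*_1=\{(Q^i,C^{-i}): i\in I\}$. For $\xi\in[0,1]^I$ and $a\in A$ set $\xi(a)=\prod_{i:a^i=Q^i}\xi^i\cdot\prod_{i:a^i=C^i}(1-\xi^i)$. $Q$-matrices. Let $R$ be an $n\times n$ real matrix with columns $R^1,\dots,R^n$ and $q\in\mathbb{R}^n$. The linear complementarity problem $\mathrm{LCP}(R,q)$ is: find $w\in\mathbb{R}^n_+$ and $z=(z_0,z_1,\dots,z_n)\in\Delta(\{0,1,\dots,n\})$ (a probability vector) such that $w=z_0q+\sum_{i=1}^nz_iR^i$ and, for each $i\in\{1,\dots,n\}$, $z_i=0$ or $w_i=0$. $R$ is a $Q$-matrix if $\mathrm{LCP}(R,q)$ has at least one solution for every $q\in\mathbb{R}^n$. Absorption paths. $\mathbf{F}$ is the set of càdlàg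 paths $\pi=(\pi_t(a))_{a\in A^*,\,t\in[0,1]}$ with values in $[0,1]^{A^*}$ such that $t\mapsto\pi_t(a)$ is nondecreasing for every $a\in A^*$. For $\pi\in\mathbf{F}$: $\pi_{0-}=0$, $\widehat\pi_t=\sum_{a\in A^*}\pi_t(a)$, $\Delta\pi_t=\pi_t-\pi_{t-}$, $T(\pi)=\{t\in[0,1]:\widehat\pi_t=t\}$, $S(\pi)=\{t\in[0,1]:\Delta\pi_t\neq0\}$, and $\dot\pi_t=\liminf_{s\searrow t}\frac{\pi_s-\pi_t}{s-t}$ (coordinatewise) for $t\in[0,1)$. An absorption path is a $\pi\in\mathbf{F}$ such that: (A.1) $\widehat\pi_t\ge t$ for all $t\in[0,1]$; (A.2) on each connected component $(t_1,t_2)$ of $[0,1]\setminus(S(\pi)\cup T(\pi))$, $\widehat\pi$ is constant and equal to $t_2$; and for every $t\in S(\pi)$, $\widehat\pi_t>t$ and $\widehat\pi_s=\widehat\pi_t$ for every $s\in[t,\widehat\pi_t)$; (A.3) for every $t\in S(\pi)$ there is $\xi_t\in[0,1]^I$ with $\Delta\pi_t(a)=(1-t)\,\xi_t(a)$ for all $a\in A^*$; (A.4) for every $t\in T(\pi)\setminus\{1\}$, $\dot\pi_t(a)=0$ for all $a\in A^*\setminus A^*_1$. An absorption path $\pi$ is continuous if $T(\pi)=[0,1]$. Payoff path: $\gamma_t(\pi)=\frac{\sum_{a\in A^*}(\pi_1(a)-\pi_t(a))r(a)}{1-\widehat\pi_t}$ if $\widehat\pi_t<1$, and $\gamma_t(\pi)=\vec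 0$ if $\widehat\pi_t=1$. Perfectness. For $y\in\mathbb{R}^I$, $G_\Gamma(y)$ is the one-shot strategic-form game with players $I$, action sets $A^i$ and payoff $r(a)$ if $a\neq\vec C$, and $y$ if $a=\vec C$ (extended multilinearly to mixed action profiles $\xi\in[0,1]^I$, $\xi^i$ being the probability of $Q^i$). In a strategic-form game with payoff $u$, player $i$ is $\varepsilon$-perfect at a mixed action profile $\xi$ if for every action $a^i\in A^i$: $u^i(a^i,\xi^{-i})\le u^i(\xi)+\varepsilon$, and, if $\xi^i$ gives $a^i$ positive probability, $u^i(a^i,\xi^{-i})\ge u^i(\xi)-\varepsilon$. Player $i$ is sequentially $\varepsilon$-perfect ($\varepsilon\ge0$) at the absorption path $\pi$ if: (SP.1) for all $t\in S(\pi)$ with $\widehat\pi_t<1$, player $i$ is $\varepsilon$-perfect at $\xi_t$ in $G_\Gamma(\gamma_t(\pi))$; (SP.2) for every $t\in T(\pi)\setminus\{1\}$: (a) $\gamma^i_t(\pi)\ge r^i(Q^i,C^{-i})-\varepsilon$, and (b) if $\dot\pi_t(Q^i,C^{-i})>0$ then $\gamma_t^i(\pi)\le r^i(Q^i,C^{-i})+\varepsilon$. The path $\pi$ is sequentially $\varepsilon$-perfect if all players are sequentially $\varepsilon$-perfect at $\pi$. A continuous equilibrium is a sequentially $0$-perfect continuous absorption path. *)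

(* Defs.v *)
From HB Require Import structures.
From mathcomp Require Import all_boot all_order all_algebra.
From mathcomp Require Import all_classical all_reals all_analysis.

Set Implicit Arguments.
Unset Strict Implicit.
Unset Printing Implicit Defensive.

Import Order.TTheory GRing.Theory Num.Theory.
Import numFieldNormedType.Exports.

Local Open Scope classical_set_scope.
Local Open Scope ring_scope.

(* Linear complementarity problems.  The weights are indexed by
   {0, 1, ..., n}: index ord0 is the weight of q, index (lift ord0 i) the
   weight of the i-th column. *)

Definition LCP_solution (R : realType) (n : nat) (M : 'M[R]_n) (q : 'cV[R]_n)
    (w : 'cV[R]_n) (z : 'I_n.+1 -> R) : Prop :=
  [/\ forall i, 0 <= w i 0,
      (forall k, 0 <= z k) /\ \sum_k z k = 1,
      w = z ord0 *: q + \sum_(i < n) z (lift ord0 i) *: col i M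
    & forall i : 'I_n, z (lift ord0 i) = 0 \/ w i 0 = 0].

Definition Q_matrix (R : realType) (n : nat) (M : 'M[R]_n) : Prop :=
  forall q : 'cV[R]_n, exists w z, LCP_solution M q w z.

(* Pure action profiles: true stands for "quit", false for "continue". *)

Definition profile (I : finType) := {ffun I -> bool}.

Definition allC (I : finType) : profile I := [ffun=> false].

Definition quit1 (I : finType) (i : I) : profile I := [ffun j => j == i].

(* xi i is the probability that player i quits. *)
Definition mixed_profile (R : realType) (I : finType) (xi : I -> R) : Prop :=
  forall i, 0 <= xi i <= 1.

Definition profile_prob (R : realType) (I : finType) (xi : I -> R)
    (a : profile I) : R :=
  (\prod_(i | a i) xi i) * (\prod_(i | ~~ a i) (1 - xi i)).

(* Strategic-form games in which each player has the two actions above. *)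

Definition expected_payoff (R : realType) (I : finType)
    (u : profile I -> I -> R) (xi : I -> R) (i : I) : R :=
  \sum_(a : profile I) profile_prob xi a * u a i.

Definition action_prob (R : realType) (I : finType) (xi : I -> R) (i : I)
    (b : bool) : R :=
  if b then xi i else 1 - xi i.

Definition deviate (R : realType) (I : finType) (xi : I -> R) (i : I)
    (b : bool) : I -> R :=
  fun j => if j == i then b%:R else xi j.

Definition eps_perfect (R : realType) (I : finType) (u : profile I -> I -> R)
    (eps : R) (xi : I -> R) (i : I) : Prop :=
  forall b : bool,
    expected_payoff u (deviate xi i b) i <= expected_payoff u xi i + eps /\
    (0 < action_prob xi i b ->
     expected_payoff u xi i - eps <= expected_payoff u (deviate xi i b) i).

(* A quitting game with player set I is given by its payoff function
   r : profile I -> I -> R; the value r (allC I) is never used. *)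

Definition one_shot (R : realType) (I : finType) (r : profile I -> I -> R)
    (y : I -> R) : profile I -> I -> R :=
  fun a i => if a == allC I then y i else r a i.

(* The rows and columns for the players in J are numbered along enum J. *)
Definition principal_quitting_matrix (R : realType) (I : finType)
    (r : profile I -> I -> R) (J : {set I}) : 'M[R]_#|J| :=
  \matrix_(k < #|J|, l < #|J|) r (quit1 (enum_val l)) (enum_val k).

Definition quitting_matrix (R : realType) (I : finType)
    (r : profile I -> I -> R) : 'M[R]_#|[set: I]%SET| :=
  principal_quitting_matrix r [set: I]%SET.

(* Paths are total functions of a time t and a profile a; only the values at
   0 <= t <= 1 and a != allC I are ever constrained or used. *)

Section Paths.
Context {R : realType} {I : finType}.
Implicit Types (pi : R -> profile I -> R) (t : R).

Record monotone_cadlag_path pi : Prop := MonotoneCadlagPath {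
  path_itv : forall a t, a != allC I -> 0 <= t <= 1 -> 0 <= pi t a <= 1 ;
  path_nondecr : forall a s t, a != allC I ->
    0 <= s -> s <= t -> t <= 1 -> pi s a <= pi t a ;
  path_right_cont : forall a t, a != allC I -> 0 <= t < 1 ->
    pi s a @[s --> t^'+] --> pi t a ;
  path_left_lim : forall a t, a != allC I -> 0 < t <= 1 ->
    cvg (pi s a @[s --> t^'-])
}.

Definition path_total pi t : R := \sum_(a | a != allC I) pi t a.

Definition path_left pi t (a : profile I) : R :=
  if t <= 0 then 0 else lim (pi s a @[s --> t^'-]).

Definition path_jump pi t (a : profile I) : R := pi t a - path_left pi t a.

Definition path_T pi : set R := [set t | 0 <= t <= 1 /\ path_total pi t = t].

Definition path_S pi : set R :=
  [set t | 0 <= t <= 1 /\ exists2 a, a != allC I & path_jump pi t a != 0].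

(* The lower right derivative may be +oo, hence the extended reals. *)
Definition path_dot pi t (a : profile I) : \bar R :=
  limf_einf (fun s => ((pi s a - pi t a) / (s - t))%:E) t^'+.

(* For t < 1, a jump determines its mixed profile uniquely: the probabilities
   of all profiles but allC I, hence also of allC I, are determined. *)
Definition jump_profile pi t (xi : I -> R) : Prop :=
  mixed_profile xi /\
  forall a, a != allC I -> path_jump pi t a = (1 - t) * profile_prob xi a.

Definition gap_set pi : set R := `[0, 1]%classic `\` (path_S pi `|` path_T pi).

Record absorption_path pi : Prop := AbsorptionPath {
  absorption_cadlag : monotone_cadlag_path pi ;
  absorption_ge : forall t, 0 <= t <= 1 -> t <= path_total pi t ;
  absorption_gap : forall x, gap_set pi x -> exists t1 t2 : R,
    connected_component (gap_set pi) x = `]t1, t2[%classic /\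
    forall t, t1 < t < t2 -> path_total pi t = t2 ;
  absorption_after_jump : forall t, path_S pi t ->
    t < path_total pi t /\
    forall s, s <= 1 -> t <= s < path_total pi t ->
      path_total pi s = path_total pi t ;
  absorption_jump : forall t, path_S pi t -> exists xi, jump_profile pi t xi ;
  absorption_dot : forall t, path_T pi t -> t != 1 ->
    forall a, a != allC I -> (forall i, a != quit1 i) -> path_dot pi t a = 0%E
}.

Definition continuous_path pi : Prop := path_T pi = `[0, 1]%classic.

Definition payoff_path (r : profile I -> I -> R) pi t (i : I) : R :=
  if path_total pi t < 1 then
    (\sum_(a | a != allC I) (pi 1 a - pi t a) * r a i) / (1 - path_total pi t)
  else 0.

Record player_seq_perfect (r : profile I -> I -> R) (eps : R) pi (i : I)
    : Prop := PlayerSeqPerfect {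
  seq_perfect_jump : forall t, path_S pi t -> path_total pi t < 1 ->
    forall xi, jump_profile pi t xi ->
      eps_perfect (one_shot r (payoff_path r pi t)) eps xi i ;
  seq_perfect_ge : forall t, path_T pi t -> t != 1 ->
    r (quit1 i) i - eps <= payoff_path r pi t i ;
  seq_perfect_le : forall t, path_T pi t -> t != 1 ->
    (0 < path_dot pi t (quit1 i))%E ->
    payoff_path r pi t i <= r (quit1 i) i + eps
}.

Definition seq_perfect (r : profile I -> I -> R) (eps : R) pi : Prop :=
  forall i, player_seq_perfect r eps pi i.

Definition continuous_equilibrium (r : profile I -> I -> R) pi : Prop :=
  [/\ absorption_path pi, continuous_path pi & seq_perfect r 0 pi].

End Paths.

(* Main.v *)
Require Import Defs.
(* Idea.  Run time backwards and let [x_s] be the vector of masses still to be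
   absorbed when a total mass [s] is left: the payoff path is then [m x_s / s]
   for the payoff matrix [m].  One needs a nondecreasing path with [x_0 = 0],
   [sum_i x_s i = s] and [m x_s >= 0], along which coordinate [i] grows only
   where [(m x_s)_i = 0].  Keep [x] on the boundary [min_i (m x)_i = 0]: if [J]
   is the set of players whose payoff at [x] is almost 0, the Q-matrix property
   for [J] and the right-hand side [-1] gives a direction [u] on [J] with
   [m u >= 0] on [J], while the vertex [e_i], where [(m x)_i = 0], does not move
   the [i]-th payoff because [m i i = 0].  Between [u] and [e_i] there is a
   direction along which a step of fixed length [h] ends again on the boundary.
   A limit of these discrete paths along an ultrafilter, as [h -> 0], is the
   path sought. *)
From HB Require Import structures.
From mathcomp Require Import all_boot all_order all_algebra.
From mathcomp Require Import all_classical all_reals all_analysis.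
From mathcomp Require Import ring lra.

Set Implicit Arguments.
Unset Strict Implicit.
Unset Printing Implicit Defensive.

Import Order.TTheory GRing.Theory Num.Theory.
Import numFieldNormedType.Exports.

Local Open Scope ring_scope.

(** * Compactness, affine functions and linear complementarity *)

(** Compactness of the segment gives a cluster point, and an ultrafilter converges to each of its
    cluster points. *)
Lemma ultra_bounded_cvg (R : realType) (T : Type) (U : set_system T)
    (f : T -> R) (a b : R) :
  UltraFilter U -> (forall x, a <= f x <= b) ->
  exists l : R, (f @ U --> l)%classic.
Proof.
move=> U_ultra f_itv; have U_proper : ProperFilter U by exact: ultra_proper.
have [|l [_ l_cluster]] := @segment_compact R a b (f @ U)%classic _.
  by apply: (@filterE _ U) => x; rewrite /= in_itv /=.
exists l => B l_B.
have [//|fB'] := in_ultra_setVsetC (f @^-1` B)%classic U_ultra.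
by have [x [/= ]] := l_cluster (~` B)%classic B fB' l_B.
Qed.

(** The minimum over [P] of the affine functions from [a j] to [c j] is nonnegative at 0 and,
    because of [i], at most 0 at 1; it vanishes in between. *)
Lemma segment_hits_zero_minimum (R : realType) (J : finType) (P : pred J)
    (a c : J -> R) (i : J) :
  P i -> (forall j, P j -> 0 <= a j) -> c i <= 0 ->
  exists th, [/\ 0 <= th <= 1,
    forall j, P j -> 0 <= (1 - th) * a j + th * c j
    & exists2 j, P j & (1 - th) * a j + th * c j = 0].
Proof.
move=> Pi a_ge0 ci_le0.
(* The first [th] at which the affine function from [a j] to [c j] vanishes; it
   is [0], as it should be, also when [a j = c j = 0]. *)
pose th j := a j / (a j - c j).
have th_itv j : P j -> c j <= 0 -> 0 <= th j <= 1.
  move=> /a_ge0 aj cj; have d_ge0 : 0 <= a j - c j by lra.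
  rewrite /th divr_ge0 //=.
  have [->|d_neq0] := eqVneq (a j - c j) 0; first by rewrite invr0 mulr0.
  by rewrite ler_pdivrMr ?mul1r ?lt_def ?d_neq0 //; lra.
have th0 j : P j -> c j <= 0 -> a j = th j * (a j - c j).
  move=> /a_ge0 aj cj; rewrite /th.
  have [d0|d_neq0] := eqVneq (a j - c j) 0; first by rewrite d0 mulr0; lra.
  by rewrite mulfVK.
have Qi : P i && (c i <= 0) by rewrite Pi.
case: (arg_minP (P := fun j => P j && (c j <= 0)) th Qi).
move=> j /andP[Pj cj] th_min.
have /andP[thj0 thj1] := th_itv _ Pj cj.
exists (th j); split; first by rewrite thj0.
- move=> k Pk; have [ck|ck] := leP (c k) 0; last first.
    by apply: addr_ge0; apply: mulr_ge0; rewrite ?a_ge0 ?(ltW ck) ?subr_ge0.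
  have := th0 _ Pk ck; have ak := a_ge0 _ Pk.
  have : th j * (a k - c k) <= th k * (a k - c k).
    by apply: ler_wpM2r; [lra | apply: th_min; rewrite Pk].
  by lra.
- by exists j => //; have := th0 _ Pj cj; lra.
Qed.

(** For the right-hand side -1, the columns weighted by [z] add up to [w] plus the weight of index
    [ord0], hence to a nonnegative vector. If that weight were 1, then [w] would be -1; so the
    column weights can be normalized. *)
Lemma Q_matrix_nonneg_direction (R : realType) (I : finType)
    (r : profile I -> I -> R) (J : {set I}) :
  J != finset.set0 -> Q_matrix (principal_quitting_matrix r J) ->
  exists v : I -> R, [/\ forall i, 0 <= v i, \sum_i v i = 1,
    forall i, i \notin J -> v i = 0
    & forall i, i \in J -> 0 <= \sum_j r (quit1 j) i * v j].
Proof.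
move=> J_neq0 /(_ (const_mx (-1))) [w [z [w_ge0 [z_ge0 z_sum] wE _]]].
have {}wE k : \sum_l z (lift ord0 l) * r (quit1 (enum_val l)) (enum_val k)
    = w k 0 + z ord0.
  rewrite wE !mxE summxE mulrN1 addrAC addNr add0r.
  by apply: eq_bigr => l _; rewrite !mxE.
rewrite big_ord_recl /= in z_sum.
have [i0 Ji0] : exists i, i \in J by apply/set0Pn.
have z_lt1 : 0 < 1 - z ord0.
  rewrite lt_def subr_eq0 subr_ge0 -[X in _ <= X]z_sum lerDl sumr_ge0 // andbT.
  apply/eqP => z0; have /psumr_eq0P zl0 : \sum_l z (lift ord0 l) = 0 by lra.
  have := wE (enum_rank_in Ji0 i0); rewrite big1; last first.
    by move=> l _; rewrite zl0 ?mul0r.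
  by have := w_ge0 (enum_rank_in Ji0 i0); lra.
pose v i := if i \in J then z (lift ord0 (enum_rank_in Ji0 i)) / (1 - z ord0)
            else 0.
have vE (F : I -> R) : \sum_j F j * v j
    = (\sum_l z (lift ord0 l) * F (enum_val l)) / (1 - z ord0).
  rewrite (bigID (mem J)) /= [X in _ + X]big1 ?addr0; last first.
    by move=> j Jj; rewrite /v (negbTE Jj) mulr0.
  rewrite [LHS]big_enum_val /= mulr_suml; apply: eq_bigr => l _.
  by rewrite /v enum_valP enum_valK_in mulrA [F _ * _]mulrC.
exists v; split.
- by move=> i; rewrite /v; case: ifP => // _; rewrite divr_ge0 // ltW.
- under eq_bigr do rewrite -[v _]mul1r.
  rewrite vE; under eq_bigr do rewrite mulr1.
  by rewrite (_ : \sum_l z (lift ord0 l) = 1 - z ord0) ?divff ?gt_eqF //; lra.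
- by move=> i Ji; rewrite /v (negbTE Ji).
- move=> i Ji; rewrite vE -(enum_rankK_in Ji0 Ji) wE divr_ge0 ?(ltW z_lt1) //.
  by rewrite addr_ge0.
Qed.

(** Here [q] and [p] are [s] and [t] rounded down to the grid of mesh [h], [u] is a grid time
    between them, and [K], [L] are the payoffs at [u] and [p]. One [h] pays for the rounding of [s],
    the other is the margin left over the threshold. *)
Lemma step_threshold_arith (R : realType) (B s t h p q u K L : R) :
  0 <= B -> q <= u -> s - h < q -> p <= t ->
  B * (t - s + 2 * h) < L -> L - K <= B * (p - u) -> B * h < K.
Proof.
move=> B_ge0 qu sq pt BL LK.
have : B * (p - u) <= B * (t - s + h) by rewrite ler_wpM2l //; lra.
by lra.
Qed.

(** * Discrete viable paths *)

Section Discretization.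
Local Open Scope classical_set_scope.
Local Open Scope ring_scope.
Variables (R : realType) (I : finType) (m : I -> I -> R).

Definition lin_payoff (x : I -> R) i := \sum_j m i j * x j.
(** A crude common Lipschitz constant of all payoffs for the l1 norm. *)
Definition payoff_bound : R := \sum_i \sum_j `|m i j|.

Lemma payoff_bound_ge0 : 0 <= payoff_bound.
Proof. by rewrite sumr_ge0 // => i _; rewrite sumr_ge0. Qed.

Lemma lin_payoff_bound (x : I -> R) i : (forall j, 0 <= x j) ->
  `|lin_payoff x i| <= payoff_bound * \sum_j x j.
Proof.
move=> x_ge0; rewrite mulr_sumr (le_trans (ler_norm_sum _ _ _)) //.
apply: ler_sum => j _; rewrite normrM (ger0_norm (x_ge0 j)) ler_wpM2r //.
rewrite /payoff_bound (bigD1 i) //= (bigD1 j) //= -addrA lerDl.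
rewrite addr_ge0 ?sumr_ge0 //.
by move=> k _; rewrite sumr_ge0.
Qed.

Lemma lin_payoffD x y a i :
  lin_payoff (fun j => x j + a * y j) i = lin_payoff x i + a * lin_payoff y i.
Proof.
by rewrite /lin_payoff mulr_sumr -big_split; apply: eq_bigr => j _ /=; ring.
Qed.

Hypothesis m_diag : forall i, m i i = 0.
Hypothesis m_dir : forall J : {set I}, J != finset.set0 ->
  exists v : I -> R, [/\ forall i, 0 <= v i, \sum_i v i = 1,
    forall i, i \notin J -> v i = 0 & forall i, i \in J -> 0 <= lin_payoff v i].

Definition boundary_state x :=
  (forall i, 0 <= lin_payoff x i) /\ exists i, lin_payoff x i = 0.

Lemma viable_step (h : R) x : 0 < h -> boundary_state x ->
  exists v : I -> R, [/\ forall i, 0 <= v i, \sum_i v i = 1,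
    forall i, 0 < v i -> lin_payoff x i <= payoff_bound * h
    & boundary_state (fun i => x i + h * v i)].
Proof.
move=> h_gt0 [x_ge0 [i0 xi0]].
(* Over a step of length [h] no payoff changes by more than [payoff_bound * h],
   so the players outside [J] impose no constraint on the direction. *)
pose J := [set i | lin_payoff x i <= payoff_bound * h]%SET.
have Ji0 : i0 \in J by rewrite inE xi0 mulr_ge0 ?payoff_bound_ge0 // ltW.
have J_neq0 : J != finset.set0 by apply/set0Pn; exists i0.
have [u [u_ge0 u_sum u_J lin_u]] := m_dir J_neq0.
pose e j : R := (j == i0)%:R.
have lin_e i : lin_payoff e i = m i i0.
  rewrite /lin_payoff (bigD1 i0) //= /e eqxx mulr1 big1 ?addr0 //.
  by move=> j /negbTE ->; rewrite mulr0.
have [|||th [th_itv th_ge0 [k Jk th_k]]] := @segment_hits_zero_minimum R I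
  (mem J) (fun i => lin_payoff x i + h * lin_payoff u i)
  (fun i => lin_payoff x i + h * lin_payoff e i) i0.
- by [].
- by move=> i /lin_u ui; rewrite addr_ge0 // mulr_ge0 // ltW.
- by rewrite lin_e m_diag xi0 mulr0 addr0.
pose v j := (1 - th) * u j + th * e j.
have v_ge0 j : 0 <= v j.
  by rewrite /v addr_ge0 // mulr_ge0 // ?subr_ge0; case/andP: th_itv.
have v_sum : \sum_j v j = 1.
  have e_sum : \sum_j e j = 1.
    by rewrite (bigD1 i0) //= /e eqxx big1 ?addr0 // => j /negbTE ->.
  by rewrite big_split /= -!mulr_sumr u_sum e_sum; ring.
have lin_v i : lin_payoff v i = (1 - th) * lin_payoff u i + th * lin_payoff e i.
  rewrite /lin_payoff !mulr_sumr -big_split; apply: eq_bigr => j _ /=.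
  by rewrite /v; ring.
have linE i : lin_payoff (fun i => x i + h * v i) i
    = (1 - th) * (lin_payoff x i + h * lin_payoff u i)
      + th * (lin_payoff x i + h * lin_payoff e i).
  by rewrite lin_payoffD lin_v; ring.
exists v; split=> //.
(* Both [u] and [e] are supported in [J], hence so is [v]. *)
- move=> i; case: (boolP (i \in J)) => [|Ji]; first by rewrite inE.
  have /negbTE i_neq : i != i0 by apply: contraNneq Ji => ->.
  by rewrite /v /e u_J // i_neq !mulr0 addr0 ltxx.
- split; last by exists k; rewrite linE.
  move=> i; case: (boolP (i \in J)) => [Ji|]; first by rewrite linE th_ge0.
  rewrite inE -ltNge lin_payoffD => xi.
  have := lin_payoff_bound i v_ge0.
  rewrite v_sum mulr1 ler_norml => /andP[vi _].
  have : h * (- payoff_bound) <= h * lin_payoff v i by rewrite ler_wpM2l // ltW.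
  by lra.
Qed.

Lemma discrete_viable_path (h : R) : (0 < #|I|)%N -> 0 < h ->
  exists y : nat -> I -> R, [/\ (forall i, y 0 i = 0),
    forall k i, y k i <= y k.+1 i,
    forall k, \sum_i y k i = k%:R * h,
    forall k i, 0 <= lin_payoff (y k) i
    & forall k i, y k i < y k.+1 i -> lin_payoff (y k) i <= payoff_bound * h].
Proof.
move=> /card_gt0P[i0 _] h_gt0.
have /choice[v vP] x : exists v : I -> R, boundary_state x ->
    [/\ forall i, 0 <= v i, \sum_i v i = 1,
        forall i, 0 < v i -> lin_payoff x i <= payoff_bound * h
      & boundary_state (fun i => x i + h * v i)].
  have [/(viable_step h_gt0)[v vP]|not_good] := pselect (boundary_state x).
    by exists v.
  (* A default direction; the iteration below never leaves the boundary states. *)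
  by exists (fun=> 0).
pose y k := iter k (fun x i => x i + h * v x i) (fun=> 0).
have lin0 i : lin_payoff (fun=> 0) i = 0.
  by rewrite /lin_payoff big1 // => j _; rewrite mulr0.
have y_good k : boundary_state (y k).
  elim: k => [|k /vP[]//].
  by split; [move=> i; rewrite lin0 | exists i0; rewrite lin0].
exists y; split=> //.
- move=> k i; have [v_ge0 _ _ _] := vP _ (y_good k).
  by rewrite /= lerDl mulr_ge0 // ltW.
- elim=> [|k IHk]; first by rewrite mul0r big1.
  have [_ v_sum _ _] := vP _ (y_good k).
  by rewrite /= big_split /= -mulr_sumr v_sum IHk -natr1 mulrDl mulr1 mul1r.
- by move=> k; case: (y_good k).
- move=> k i; have [_ _ v_lin _] := vP _ (y_good k).
  by rewrite /= ltrDl pmulr_rgt0 //; apply: v_lin.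
Qed.

(** * Passage to the limit along an ultrafilter *)

(** A payoff above [payoff_bound * (t - s)] at [t] is positive on all of [[s, t]], so the last
    clause expresses that a coordinate grows only where its payoff vanishes, in a form that survives
    the limit. *)
Lemma viable_path : (0 < #|I|)%N ->
  exists X : R -> I -> R, [/\ (forall (s : R) i, 0 <= X s i),
    forall (s t : R) i, s <= t -> X s i <= X t i,
    forall s : R, 0 <= s -> \sum_i X s i = s,
    forall (s : R) i, 0 <= s -> 0 <= lin_payoff (X s) i
    & forall (s t : R) i, 0 <= s <= t ->
        payoff_bound * (t - s) < lin_payoff (X t) i -> X s i = X t i].
Proof.
move=> I_gt0.
(* Along one ultrafilter the discrete paths converge at all real times at once, without extraction
   of subsequences. *)
have [U [U_ultra U_oo]] :=
  ultraFilterLemma (@eventually_filter : ProperFilter \oo).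
have U_proper : ProperFilter U by exact: ultra_proper.
have /choice[y yP] N : exists y : nat -> I -> R, [/\ (forall i, y 0 i = 0),
    forall k i, y k i <= y k.+1 i,
    forall k, \sum_i y k i = k%:R * (N.+1%:R)^-1,
    forall k i, 0 <= lin_payoff (y k) i
    & forall k i, y k i < y k.+1 i ->
        lin_payoff (y k) i <= payoff_bound * (N.+1%:R)^-1].
  by apply: discrete_viable_path => //; rewrite invr_gt0.
(* The number of steps of length [N.+1%:R^-1] that fit into [s]. It is 0 for negative [s], so
   monotonicity holds on the whole line. *)
pose k N (s : R) := Num.truncn (N.+1%:R * s).
have y_mono N i : {homo (y N)^~ i : a b / (a <= b)%N >-> a <= b}.
  by apply: homo_leq => [//|? ? ?|a]; [exact: le_trans | case: (yP N)].
have y_ge0 N a i : 0 <= y N a i.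
  by have [y0 _ _ _ _] := yP N; rewrite -(y0 i) y_mono.
have k_le N (s : R) : 0 <= s -> (k N s)%:R / N.+1%:R <= s.
  by move=> s_ge0; rewrite ler_pdivrMr // mulrC truncn_le mulr_ge0.
have k_gt N (s : R) : 0 <= s -> s - N.+1%:R^-1 < (k N s)%:R / N.+1%:R.
  move=> s_ge0; rewrite ltrBlDr -[X in _ + X]mul1r -mulrDl ltr_pdivlMr //.
  by rewrite mulrC natr1 -truncn_le_nat.
have y_le N s i : 0 <= y N (k N s) i <= `|s|.
  rewrite y_ge0 /=; apply: (@le_trans _ _ (y N (k N `|s|) i)).
    by apply/y_mono/le_truncn; rewrite ler_wpM2l // ler_norm.
  have [_ _ y_sum _ _] := yP N.
  apply: le_trans (k_le N _ (normr_ge0 s)); rewrite -y_sum (bigD1 i) //=.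
  by rewrite lerDl sumr_ge0.
have /choice[X XP] s : exists l : I -> R,
    forall i, y N (k N s) i @[N --> U] --> l i.
  have /choice[l lP] i : exists l : R, y N (k N s) i @[N --> U] --> l.
    by apply: ultra_bounded_cvg => N; exact: y_le.
  by exists l.
have X_lin s i : lin_payoff (y N (k N s)) i @[N --> U] --> lin_payoff (X s) i.
  apply: cvg_big => [|j _]; first exact: add_continuous.
  by apply: cvgMl_tmp; exact: XP.
have U_inv : N.+1%:R^-1 @[N --> U] --> (0 : R).
  by move=> B /cvg_harmonic; apply: U_oo.
exists X; split.
- move=> s i; apply: (cvgr_to_ge (XP s i)); apply: nearW => N.
  by case/andP: (y_le N s i).
- move=> s t i st; apply: (ler_cvg_to (XP s i) (XP t i)); apply: nearW => N.
  by apply/y_mono/le_truncn; rewrite ler_wpM2l.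
- move=> s s_ge0; have X_sum : \sum_i y N (k N s) i @[N --> U] --> \sum_i X s i.
    by apply: cvg_big => [|j _]; [exact: add_continuous | exact: XP].
  apply: (norm_cvg_unique X_sum).
  apply: (@squeeze_cvgr _ _ _ _ (fun N => s - N.+1%:R^-1) (fun=> s)).
  + apply: nearW => N; have [_ _ -> _ _] := yP N.
    by rewrite k_le // ltW // k_gt.
  + by rewrite -[X in _ --> X]subr0; apply: cvgB => //; exact: cvg_cst.
  + exact: cvg_cst.
- move=> s i _; apply: (cvgr_to_ge (X_lin s i)); apply: nearW => N.
  by have [_ _ _ y_lin _] := yP N.
- move=> s t i /andP[s_ge0 st] X_gt.
  (* The two extra mesh lengths required by [step_threshold_arith] disappear in the limit, so the
     strict inequality [X_gt] leaves room for them. *)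
  have : payoff_bound * (t - s + 2 * N.+1%:R^-1) @[N --> U]
      --> payoff_bound * (t - s + 2 * 0).
    apply: cvgMl_tmp; apply: cvgD; first exact: cvg_cst.
    exact: cvgMl_tmp.
  rewrite mulr0 addr0 => bound_cvg.
  apply: (norm_cvg_unique (XP s i)).
  apply: cvg_trans (XP t i); apply: near_eq_cvg.
  have : \forall N \near U, 0 < lin_payoff (y N (k N t)) i
      - payoff_bound * (t - s + 2 * N.+1%:R^-1).
    apply: (cvgr_gt (lin_payoff (X t) i - payoff_bound * (t - s))).
      exact: cvgB.
    by rewrite subr_gt0.
  apply: filterS => N; rewrite subr_gt0 => lin_gt.
  have [_ _ y_sum _ y_slow] := yP N.
  have kst : (k N s <= k N t)%N by apply/le_truncn; rewrite ler_wpM2l.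
  apply/esym/eqP; rewrite eq_le y_mono //=.
  (* Until step [k N t], the payoff of [i] stays above the threshold
     [payoff_bound * N.+1%:R^-1] below which [y N] may increase in direction
     [i]. *)
  have const a : (k N s <= a < k N t)%N -> y N a.+1 i <= y N a i.
    move=> /andP[sa at_]; rewrite leNgt; apply/negP => /y_slow.
    have := @lin_payoff_bound (fun j => y N (k N t) j + -1 * y N a j) i.
    rewrite lin_payoffD big_split /= -mulr_sumr !y_sum !mulN1r ler_norml.
    case/(_ _)/andP => [j|_ lin_le].
      by rewrite mulN1r subr_ge0 y_mono // ltnW.
    have := k_le N t (le_trans s_ge0 st); have := k_gt N s s_ge0.
    have sa_le : (k N s)%:R / N.+1%:R <= a%:R / N.+1%:R :> R.
      by rewrite ler_wpM2r // ler_nat.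
    move=> k_s k_t; apply/negP; rewrite -ltNge.
    exact: (step_threshold_arith payoff_bound_ge0 sa_le k_s k_t lin_gt lin_le).
  elim: (k N t) kst const => [|n IHn] sn const.
    by move: sn; rewrite leqn0 => /eqP ->.
  move: sn; rewrite leq_eqVlt => /predU1P[-> //|sn].
  apply: (le_trans (const n _)); first by rewrite ltnSn andbT -ltnS.
  by apply: IHn => // a /andP[sa an]; rewrite const // sa ltnS ltnW.
Qed.
End Discretization.

(** * Lower derivatives and one-sided limits *)

Lemma limf_einf_near0 (R : realType) (f : R -> \bar R) (F : set_system R) :
  ProperFilter F -> (\forall x \near F, f x = 0%E) -> limf_einf f F = 0%E.
Proof.
move=> F_proper f0; rewrite limf_einfE; apply/eqP.
rewrite eq_le; apply/andP; split.
- apply: ge_ereal_sup => _ [V FV <-].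
  have [x [fx Vx]] := filter_ex (filterI f0 FV).
  by apply: ereal_inf_lbound; exists x.
- pose Z := [set x | f x = 0%E]%classic.
  apply: le_ereal_sup_tmp.
  exists (ereal_inf (f @` Z)%classic); first by exists Z.
  by apply: le_ereal_inf_tmp => _ [x -> <-].
Qed.

Section Lipschitz.
Local Open Scope classical_set_scope.
Local Open Scope ring_scope.
Variables (R : realType) (f : R -> R).
Hypothesis f_lip : forall s t : R, 0 <= s -> s <= t -> t <= 1 ->
  0 <= f t - f s <= t - s.

Lemma lipschitz_right_cont (t : R) : 0 <= t < 1 -> f s @[s --> t^'+] --> f t.
Proof.
move=> /andP[t_ge0 t_lt1].
apply: (@squeeze_cvgr _ _ _ _ (fun=> f t) (fun s : R => f t + (s - t))).
- near=> s; have := @f_lip t s t_ge0.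
  have ts : t <= s by near: s; exact: nbhs_right_ge.
  have s1 : s <= 1 by near: s; exact: nbhs_right_le.
  by move=> /(_ ts s1); lra.
- exact: cvg_cst.
- rewrite -[X in _ --> X]addr0 -[X in _ + X](subrr t).
  apply: cvg_at_right_filter; apply: cvgD; first exact: cvg_cst.
  by apply: cvgB => //; exact: cvg_cst.
Unshelve. all: by end_near. Qed.

Lemma lipschitz_left_cont (t : R) : 0 < t <= 1 -> f s @[s --> t^'-] --> f t.
Proof.
move=> /andP[t_gt0 t_le1].
apply: (@squeeze_cvgr _ _ _ _ (fun s : R => f t + (s - t)) (fun=> f t)).
- near=> s; have s0 : 0 <= s by near: s; exact: nbhs_left_ge.
  have st : s <= t by near: s; exact: nbhs_left_le.
  by have := f_lip s0 st t_le1; lra.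
- rewrite -[X in _ --> X]addr0 -[X in _ + X](subrr t).
  apply: cvg_at_left_filter; apply: cvgD; first exact: cvg_cst.
  by apply: cvgB => //; exact: cvg_cst.
- exact: cvg_cst.
Unshelve. all: by end_near. Qed.
End Lipschitz.

(** * Profiles with a single quitter *)

Lemma quit1_neq_allC (I : finType) (i : I) : quit1 i != allC I.
Proof. by apply/eqP => /ffunP/(_ i); rewrite !ffunE eqxx. Qed.

Lemma quit1_inj (I : finType) : injective (@quit1 I).
Proof.
by move=> i j /ffunP/(_ i); rewrite !ffunE eqxx => /esym/eqP.
Qed.

(** The inner sum carries weights on players over to profiles and is empty unless exactly one player
    quits in [a]. The absorption path has this form. *)
Lemma sum_quit1 (R : realType) (I : finType) (F : I -> R) (g : profile I -> R) :
  \sum_(a | a != allC I) (\sum_(i | quit1 i == a) F i) * g a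
    = \sum_i F i * g (quit1 i).
Proof.
rewrite (partition_big (@quit1 I) (fun a => a != allC I)) /=; last first.
  by move=> i _; exact: quit1_neq_allC.
apply: eq_bigr => a _; rewrite mulr_suml.
by apply: eq_bigr => i /eqP ->.
Qed.

(** * The continuous equilibrium *)

Theorem theorem5p2 (R : realType) (I : finType) (I_gt0 : (0 < #|I|)%N)
    (r : profile I -> I -> R)
    (r_quit1 : forall i, r (quit1 i) i = 0)
    (r_Q : Q_matrix (quitting_matrix r))
    (r_Q_principal : forall J : {set I}, J != finset.set0 ->
       Q_matrix (principal_quitting_matrix r J)) :
  exists pi : R -> profile I -> R, continuous_equilibrium r pi.
Proof.
pose m i j := r (quit1 j) i.
have [J J_neq0|X [X_ge0 X_mono X_sum X_pay X_const]] :=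
  @viable_path R I m r_quit1 _ I_gt0.
  by apply: Q_matrix_nonneg_direction => //; exact: r_Q_principal.
(* Time is reversed: at time [t] the mass [1 - t] is left, distributed as [X (1 - t)]. *)
pose pi (t : R) (a : profile I) :=
  \sum_(i | quit1 i == a) (X 1 i - X (1 - t) i).
have X0 i : X 0 i = 0 by apply: (psumr_eq0P _ (X_sum 0 _)) => // j _.
have pi_sum (t : R) g : \sum_(a | a != allC I) pi t a * g a
    = \sum_i (X 1 i - X (1 - t) i) * g (quit1 i) by rewrite sum_quit1.
have piB (s t : R) a : pi t a - pi s a
    = \sum_(i | quit1 i == a) (X (1 - s) i - X (1 - t) i).
  by rewrite /pi -sumrB; apply: eq_bigr => i _; ring.
have pi_lip a (s t : R) : 0 <= s -> s <= t -> t <= 1 ->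
    0 <= pi t a - pi s a <= t - s.
  move=> s0 st t1; have X_le i : 0 <= X (1 - s) i - X (1 - t) i.
    by rewrite subr_ge0 X_mono // lerD2l lerN2.
  rewrite piB sumr_ge0 //=.
  (* The total moves at unit speed and no coordinate decreases, so each increment is at most
     [t - s]. *)
  have -> : t - s = \sum_i (X (1 - s) i - X (1 - t) i).
    by rewrite sumrB !X_sum; lra.
  rewrite [leRHS](bigID (fun i => quit1 i == a)) /= lerDl sumr_ge0 //.
have pi_total (t : R) : 0 <= t <= 1 -> path_total pi t = t.
  move=> /andP[t0 t1]; have := pi_sum t (fun=> 1).
  under eq_bigr do rewrite mulr1.
  by under [RHS]eq_bigr do rewrite mulr1; rewrite sumrB !X_sum /path_total; lra.
have pi0 a : pi 0 a = 0.
  by rewrite /pi big1 // => i _; rewrite subr0 subrr.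
(* At 0 the left value is 0 by convention and agrees with [pi0]; at later times continuity
   applies. *)
have S0 t : ~ path_S pi t.
  move=> [/andP[t0 t1]] [a _ /eqP]; apply; rewrite /path_jump /path_left.
  have [t_le0|t_gt0] := leP t 0.
    by rewrite (_ : t = 0) ?pi0 ?subrr //; lra.
  apply/eqP; rewrite subr_eq0; apply/eqP/esym/cvg_lim; first exact: Rhausdorff.
  by apply: lipschitz_left_cont; [exact: pi_lip | rewrite t_gt0].
have T01 : path_T pi = `[0, 1]%classic.
  apply/seteqP; split=> t /=; rewrite in_itv /=; first by case.
  by move=> t01; split=> //; exact: pi_total.
(* Since [X 0 = 0], the mass absorbed after [t] is exactly [X (1 - t)]. *)
have payE (t : R) j : 0 <= t < 1 ->
    payoff_path r pi t j = lin_payoff m (X (1 - t)) j / (1 - t).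
  move=> /andP[t0 t1]; rewrite /payoff_path pi_total ?t0 ?ltW // t1.
  congr (_ / _).
  under eq_bigr do rewrite mulrBl.
  rewrite sumrB !pi_sum -sumrB; apply: eq_bigr => i _.
  by rewrite subrr X0 /m; ring.
have dot0 t a : t < 1 -> (\forall s \near t^'+, pi s a = pi t a)%classic ->
    path_dot pi t a = 0%E.
  move=> t1 pi_near; apply: limf_einf_near0.
  by apply: filterS pi_near => s ->; rewrite subrr mul0r.
exists pi; split=> //.
- split.
  + split.
    * move=> a t _ /andP[t0 t1]; have := pi_lip a 0 t (lexx _) t0 t1.
      by rewrite pi0; lra.
    * by move=> a s t _ s0 st t1; have := pi_lip a s t s0 st t1; lra.
    * by move=> a t _; apply: lipschitz_right_cont; exact: pi_lip.
    * move=> a t _ t01; apply/cvg_ex; exists (pi t a).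
      by apply: lipschitz_left_cont t01; exact: pi_lip.
  + by move=> t /pi_total ->.
  + by move=> x [x01 []]; right; rewrite T01.
  + by move=> t /S0.
  + by move=> t /S0.
  + move=> t [/andP[_ t1] _] t_neq1 a _ a_neq; apply: dot0.
      by rewrite lt_neqAle t_neq1.
    (* Profiles without exactly one quitter carry no mass at any time. *)
    by apply: nearW => s; rewrite /pi !big_pred0 // => i;
      apply/negbTE; rewrite eq_sym.
- move=> i; split=> [t /S0 //|t|t].
  + move=> [/andP[t0 t1] _] t_neq1.
    have t_lt1 : t < 1 by rewrite lt_neqAle t_neq1.
    by rewrite payE ?t0 // r_quit1 subr0 divr_ge0 ?X_pay ?subr_ge0.
  + move=> [/andP[t0 t1] _] t_neq1 dot_gt0.
    have t_lt1 : t < 1 by rewrite lt_neqAle t_neq1.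
    (* If the payoff were positive, it would exceed [payoff_bound m * (s - t)] for [s] slightly
       above [t]; then [X_const] makes the coordinate constant to the right of [t], and its lower
       derivative is 0. *)
    rewrite payE ?t0 // r_quit1 addr0 leNgt; apply/negP => pay_gt0.
    move: dot_gt0; rewrite dot0 ?ltxx //.
    have {}pay_gt0 : 0 < lin_payoff m (X (1 - t)) i.
      by move: pay_gt0; rewrite pmulr_lgt0 // invr_gt0; lra.
    have : (payoff_bound m * (s - t) @[s --> t^'+]
        --> payoff_bound m * (t - t))%classic.
      apply: cvgMl_tmp; apply: cvg_at_right_filter.
      by apply: cvgB => //; exact: cvg_cst.
    rewrite subrr mulr0 => /cvgr_lt /(_ _ pay_gt0) near_lt.
    near=> s.
    have ts : t <= s by near: s; exact: nbhs_right_ge.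
    have s1 : s <= 1 by near: s; exact: nbhs_right_le.
    apply: eq_bigr => j /eqP/quit1_inj ->; congr (_ - _).
    apply: X_const; first by apply/andP; split; lra.
    have -> : 1 - t - (1 - s) = s - t by ring.
    by near: s.
Unshelve. all: by end_near. Qed.
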